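(* Let $\mathcal{M}_1=\{A\in\mathbb{C}^{3\times3}\mid\deg(m_A)\le 2\}$ and $\mathcal{N}_1=\{A\in\mathcal{M}_1\mid\mathrm{tr}(A)=0\}$, and denote by a bar the restriction of a function on $\mathbb{C}^{3\times3}$ to $\mathcal{M}_1$. Then: (i) $\mathbb{C}[\mathcal{M}_1]^U$ is a polynomial ring in $\overline{d_1}$ over the subalgebra $\mathbb{C}[\mathcal{N}_1]^U$. (ii) There is a $\mathbb{C}$-algebra isomorphism $\eta:\mathbb{C}[z^2,z^3,D,zD]\to\mathbb{C}[\mathcal{N}_1]^U$ with $\eta(z^2)=\overline{d_2}$, $\eta(z^3)=\overline{d_3}$, $\eta(D)=\overline{c_1^U}$, $\eta(zD)=\overline{c_2^U}$, where $\mathbb{C}[z^2,z^3,D,zD]$ is the subalgebra of the polynomial ring $\mathbb{C}[z,D]$ generated by these monomials. (iii) The kernel of the surjection $\varphi:\mathbb{C}[x_0,x_1,x_2,x_3,x_4]\to\mathbb{C}[\mathcal{M}_1]^U$, $x_0\mapsto\overline{d_1}$, $x_1\mapsto\overline{d_2}$, $x_2\mapsto\overline{d_3}$, $x_3\mapsto\overline{c_1^U}$, $x_4\mapsto\overline{c_2^U}$, is generated as an ideal by $x_1^3-x_2^2$, $x_1x_4-x_2x_3$, $x_4^2-x_1x_3^2$, $x_2x_4-x_1^2x_3$.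
   Context: $m_A$ is the minimal polynomial. $G=SL(3,\mathbb{C})$ acts on $\mathbb{C}^{3\times3}$ by conjugation and on functions by $(g\cdot f)(A)=f(g^{-1}Ag)$; $\mathcal{M}_1,\mathcal{N}_1$ are $G$-stable. $U$ is the group of upper unitriangular $3\times3$ matrices; $\mathbb{C}[X]^U$ denotes $U$-invariants in the coordinate ring $\mathbb{C}[X]$. $\mathbb{C}[\mathcal{N}_1]$ is viewed as a subalgebra of $\mathbb{C}[\mathcal{M}_1]$ via $f\mapsto f\circ c_1$. For $A\in\mathbb{C}^{3\times3}$: $c_1(A)=A-\frac13\mathrm{tr}(A)I_3$, $d_1(A)=\mathrm{tr}(A)$, $d_2(A)=\frac16\mathrm{tr}(c_1(A)^2)$, $d_3(A)=\frac12\det(c_1(A))$. The functions $c_1^U,c_2^U$ are the highest weight vectors associated with the covariants $c_1(A)$ and $c_2(A)=c_1(c_1(A)^2)$, normalized so that $\overline{d_3}\,\overline{c_1^U}=\overline{d_2}\,\overline{c_2^U}$; concretely one may take $c_1^U(A)=a_{31}$ (the $(3,1)$ entry of $A$) and $c_2^U(A)=(c_1(A)^2)_{31}$. *)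

(* Defs.v *)
From HB Require Import structures.
From mathcomp Require Import all_boot all_algebra.
From mathcomp Require Import Rstruct.
From mathcomp Require Import complex.
From mathcomp Require Import mpoly.
Set Implicit Arguments. Unset Strict Implicit. Unset Printing Implicit Defensive.
Import GRing.Theory Num.Theory.
Local Open Scope ring_scope.

Definition C : closedFieldType := complex Rdefinitions.R.

Notation Mat := ('M[C]_3).

Definition mxcoords (A : Mat) : 'I_9 -> C :=
  fun k => A (inord (k %/ 3)) (inord (k %% 3)).

Definition polyfun (f : Mat -> C) : Prop :=
  exists p : {mpoly C[9]}, forall A, f A = p.@[mxcoords A].

(* M_1 = {A | deg m_A <= 2}  (size of a polynomial = degree + 1). *)
Definition inM1 (A : Mat) : bool := (size (mxminpoly A) <= 3)%N.
Definition inN1 (A : Mat) : bool := inM1 A && (\tr A == 0).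

Definition unitri (u : Mat) : Prop :=
  (forall i, u i i = 1) /\ (forall i j : 'I_3, (j < i)%N -> u i j = 0).

(* Elements of C[X]^U for a G-stable closed X (given by a predicate):
   restrictions to X of polynomial functions, U-invariant on X, where
   (u . f)(A) = f(u^{-1} A u).  Two such functions are identified when
   they agree on X. *)
Definition coordU (X : pred Mat) (f : Mat -> C) : Prop :=
  polyfun f /\
  forall u, unitri u -> forall A, X A -> f (invmx u *m A *m u) = f A.

Definition eqon (X : pred Mat) (f g : Mat -> C) : Prop :=
  forall A, X A -> f A = g A.

Definition c1 (A : Mat) : Mat := A - (\tr A / 3%:R)%:M.
Definition d1 (A : Mat) : C := \tr A.
Definition d2 (A : Mat) : C := \tr (c1 A *m c1 A) / 6%:R.
Definition d3 (A : Mat) : C := \det (c1 A) / 2%:R.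
Definition c2 (A : Mat) : Mat := c1 (c1 A *m c1 A).
(* highest weight vectors: (3,1) entries (0-based index (2,0)) *)
Definition c1U (A : Mat) : C := A (inord 2) (inord 0).
Definition c2U (A : Mat) : C := (c1 A *m c1 A) (inord 2) (inord 0).

Definition zz : {mpoly C[2]} := 'X_(inord 0).
Definition DD : {mpoly C[2]} := 'X_(inord 1).
Definition subalg_gens : 4.-tuple {mpoly C[2]} :=
  [tuple zz ^+ 2; zz ^+ 3; DD; zz * DD].
Definition in_subalg (p : {mpoly C[2]}) : Prop :=
  exists q : {mpoly C[4]}, p = q \mPo subalg_gens.

Definition phi (p : {mpoly C[5]}) (A : Mat) : C :=
  p.@[tnth [tuple d1 A; d2 A; d3 A; c1U A; c2U A]].

Definition xv (i : nat) : {mpoly C[5]} := 'X_(inord i).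

(* Main.v *)
Require Import Defs.
From HB Require Import structures.
From mathcomp Require Import all_boot all_algebra.
From mathcomp Require Import complex.
From mathcomp Require Import mpoly.
From mathcomp Require Import ring zify Rstruct.
From Stdlib Require Import ClassicalEpsilon.
Set Implicit Arguments.
Unset Strict Implicit.
Unset Printing Implicit Defensive.
Import GRing.Theory Num.Theory.
Local Open Scope ring_scope.

(* A matrix lies in M_1 iff it is a scalar plus a rank one matrix v w; hence
   N_1 consists of the matrices c1 (v w), and with z = tr (v w) / 3 and
   D = v_3 w_1 the functions d2, d3, c1U, c2U take the values z^2, z^3, D, zD
   there.  Where D <> 0, the unipotent group moves c1 (v w) to a point that
   depends only, and polynomially, on (z, D); so every invariant is a polynomial
   in z and D, first for D <> 0 and then everywhere by density.  The monomial z
   cannot occur, because the linear part of the invariant at 0 would take the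
   same value at three diagonal matrices with sum 0.  The case of M_1 follows by
   expanding in powers of the trace.  For the relations, every polynomial is
   congruent to a(x0,x1,x3) + x2 b(x0,x1,x3) + x4 c(x0,x3); if it vanishes at
   all points (t, z^2, z^3, D, zD), then comparing z with -z forces
   a = b = c = 0. *)

(** * Polynomials vanishing everywhere *)

Lemma mpoly_ring_ind n (R : nzRingType) (P : {mpoly R[n]} -> Prop) :
  (forall c, P c%:MP) -> (forall i, P 'X_i) ->
  (forall p q, P p -> P q -> P (p + q)) ->
  (forall p q, P p -> P q -> P (p * q)) -> forall p, P p.
Proof.
move=> PC PX PD PM; elim/mpolyind=> [|c m p _ _ Pp].
  by rewrite -(mpolyC0 n R).
apply: PD => //; rewrite -mul_mpolyC; apply: (PM); first exact: PC.
rewrite mpolyXE_id; apply: big_rec => [|i q _ Pq].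
  by rewrite -(mpolyC1 n R).
apply: (PM _ _ _ Pq); elim: (m i) => [|k IHk].
  by rewrite expr0 -(mpolyC1 n R).
by rewrite exprS; apply: PM.
Qed.

Lemma mpoly_rmorph_ext n (R : nzRingType) (S : pzRingType)
    (f g : {rmorphism {mpoly R[n]} -> S}) :
  (forall c, f c%:MP = g c%:MP) -> (forall i, f 'X_i = g 'X_i) -> f =1 g.
Proof.
move=> fgC fgX; elim/mpoly_ring_ind=> // p q fgp fgq.
  by rewrite !rmorphD fgp fgq.
by rewrite !rmorphM fgp fgq.
Qed.

Lemma horner_mmap_polyC n (R : comNzRingType) (h : 'I_n -> {poly R})
    (p : {mpoly R[n]}) t :
  (mmap polyC h p).[t] = p.@[fun i => (h i).[t]].
Proof.
elim/mpoly_ring_ind: p => [c|i|p q IHp IHq|p q IHp IHq].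
- by rewrite mmapC hornerC mevalC.
- by rewrite mmapX mmap1U mevalXU.
- by rewrite rmorphD hornerD IHp IHq mevalD.
- by rewrite rmorphM hornerM IHp IHq mevalM.
Qed.

Lemma poly_eval0 (F : closedFieldType) (p : {poly F}) :
  (forall t, p.[t] = 0) -> p = 0.
Proof.
move=> p0; apply/eqP; apply/negPn/negP => /closed_nonrootP[x].
by rewrite /root p0 eqxx.
Qed.

(** Induction on the number of variables: read [p] as a univariate polynomial in its last variable.
    For fixed values of the other variables it vanishes at every [t], hence is zero, so each
    coefficient vanishes everywhere and the induction hypothesis applies. *)
Lemma mpoly_eval0 (F : closedFieldType) n (p : {mpoly F[n]}) :
  (forall v, p.@[v] = 0) -> p = 0.
Proof.
elim: n p => [|n IHn] p p0.
  suff -> : p = (p.@[fun=> 0])%:MP by rewrite p0 mpolyC0.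
  elim/mpoly_ring_ind: p {p0} => [c|[] //|p q ? ?|p q ? ?].
  - by rewrite mevalC.
  - by rewrite mevalD mpolyCD; congr (_ + _).
  - by rewrite mevalM mpolyCM; congr (_ * _).
(* [u] singles out the last variable and [back] undoes it, so [u p = 0] forces [p = 0]. *)
pose X1 i : {poly {mpoly F[n]}} :=
  oapp (fun j => ('X_j)%:P) 'X (unlift ord_max i).
pose u : {rmorphism {mpoly F[n.+1]} -> {poly {mpoly F[n]}}} :=
  mmap (polyC \o @mpolyC n F) X1.
pose w : {rmorphism {mpoly F[n]} -> {mpoly F[n.+1]}} :=
  mmap (@mpolyC n.+1 F) (fun j => 'X_(lift ord_max j)).
pose back : {rmorphism {poly {mpoly F[n]}} -> {mpoly F[n.+1]}} :=
  horner_eval ('X_ord_max) \o map_poly w.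
have uC c : u c%:MP = c%:MP%:P by rewrite /u /= mmapC.
have uX i : u 'X_i = X1 i by rewrite /u /= mmapX mmap1U.
have wC c : w c%:MP = c%:MP by rewrite /w /= mmapC.
have wX i : w 'X_i = 'X_(lift ord_max i) by rewrite /w /= mmapX mmap1U.
have backK q : back (u q) = q.
  apply: (@mpoly_rmorph_ext _ _ _ (back \o u) idfun) => [c|i] /=.
    by rewrite uC /= /horner_eval map_polyC hornerC; exact: wC.
  rewrite uX /X1 /horner_eval; case: unliftP => [j|] -> /=.
    by rewrite map_polyC hornerC; exact: wX.
  by rewrite map_polyX hornerX.
have uE q v t : (map_poly (meval v) (u q)).[t] =
    q.@[fun i => oapp v t (unlift ord_max i)].
  apply: (@mpoly_rmorph_ext _ _ _ (horner_eval t \o (map_poly (meval v) \o u))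
    (meval _)) => [c|i] /=.
    by rewrite uC /horner_eval map_polyC hornerC /= !mevalC.
  rewrite uX mevalXU /= /X1 /horner_eval; case: unliftP => [j|] _ /=.
    by rewrite map_polyC hornerC /= mevalXU.
  by rewrite map_polyX hornerX.
suff u0 : u p = 0 by rewrite -[p]backK u0 raddf0.
apply/polyP => k; rewrite coef0; apply: IHn => v.
have : map_poly (meval v) (u p) = 0 by apply: poly_eval0 => t; rewrite uE p0.
by move/(congr1 (coefp k)); rewrite /= coef0 coef_map.
Qed.

Lemma mpoly_eq_eval (F : closedFieldType) n (p q : {mpoly F[n]}) :
  (forall v, p.@[v] = q.@[v]) -> p = q.
Proof.
by move=> pq; apply/eqP; rewrite -subr_eq0; apply/eqP/mpoly_eval0 => v;
   rewrite mevalB pq subrr.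
Qed.

(** * Matrices with minimal polynomial of degree at most 2 *)

Lemma natrC_neq0 n : (n.+1%:R : C) != 0.
Proof. by rewrite (pnatr_eq0 (complex Rdefinitions.R : numDomainType)). Qed.

Lemma ord3P (P : 'I_3 -> Prop) :
  P (inord 0) -> P (inord 1) -> P (inord 2) -> forall i, P i.
Proof.
move=> P0 P1 P2 i; rewrite -(inord_val i).
by case: i => [[|[|[|]]]].
Qed.

Lemma sum_ord3 (V : nmodType) (f : 'I_3 -> V) :
  \sum_i f i = f (inord 0) + f (inord 1) + f (inord 2).
Proof.
rewrite !big_ord_recl big_ord0 addr0 addrA.
by congr (f _ + f _ + f _); apply/val_inj; rewrite /= inordK.
Qed.

Lemma det_mx22 (R : comNzRingType) (A : 'M[R]_2) :
  \det A = A 0 0 * A 1 1 - A 0 1 * A 1 0.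
Proof.
rewrite (expand_det_row _ 0) !big_ord_recl big_ord0 /cofactor !det_mx11 !mxE /=.
have -> : lift 0 0 = 1 :> 'I_2 by apply/val_inj.
have -> : lift 1 0 = 0 :> 'I_2 by apply/val_inj.
by rewrite addr0 /= !(expr0, expr1) mul1r !mulNr mul1r mulrN.
Qed.

Lemma det_mx33 (R : comNzRingType) (A : 'M[R]_3)
    (a := fun i j : nat => A (inord i) (inord j)) :
  (\det A = a 0%N 0%N * (a 1%N 1%N * a 2%N 2%N - a 1%N 2%N * a 2%N 1%N)
         - a 0%N 1%N * (a 1%N 0%N * a 2%N 2%N - a 1%N 2%N * a 2%N 0%N)
         + a 0%N 2%N * (a 1%N 0%N * a 2%N 1%N - a 1%N 1%N * a 2%N 0%N))%R.
Proof.
rewrite (expand_det_row _ (inord 0)) sum_ord3 /cofactor !det_mx22 !mxE.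
have liftE (i j : nat) (k : 'I_2) : (i < 3)%N -> (j < 3)%N -> bump i k = j ->
    lift (inord i : 'I_3) k = inord j.
  by move=> i3 j3 E; apply/val_inj; rewrite /= !inordK.
have l0 : lift (inord 0 : 'I_3) 0 = inord 1 by exact: liftE.
have l1 : lift (inord 0 : 'I_3) 1 = inord 2 by exact: liftE.
have l2 : lift (inord 1 : 'I_3) 0 = inord 0 by exact: liftE.
have l3 : lift (inord 1 : 'I_3) 1 = inord 2 by exact: liftE.
have l4 : lift (inord 2 : 'I_3) 0 = inord 0 by exact: liftE.
have l5 : lift (inord 2 : 'I_3) 1 = inord 1 by exact: liftE.
rewrite l0 l1 l2 l3 l4 l5 !inordK // /a; ring.
Qed.

(** The middle factor [w *m v] is a 1 x 1 matrix, whose entry is the trace of [v *m w]. *)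
Lemma outer_sqr (R : comNzRingType) n (v : 'cV[R]_n) (w : 'rV[R]_n) :
  (v *m w) *m (v *m w) = \tr (v *m w) *: (v *m w).
Proof.
rewrite mulmxA -(mulmxA v) [w *m v]mx11_scalar mul_mx_scalar -scalemxAl.
by rewrite mxtrace_mulC {2}[w *m v]mx11_scalar mxtrace_scalar.
Qed.

(** If deg m_A <= 2, then (A - a)(A - b) = 0 for some a, b. The two ranks then add up to at most 3,
    so one factor has rank at most 1. Conversely, c + v w is annihilated by (X - c)(X - c - s),
    where s = tr (v w). *)
Lemma inM1P (A : 'M[C]_3) :
  inM1 A <-> exists c (v : 'cV_3) (w : 'rV_3), A = c%:M + v *m w.
Proof.
split=> [A_M1|[c [v [w ->]]]]; last first.
  set s := \tr (v *m w).
  pose p : {poly C} := ('X - c%:P) * ('X - (c + s)%:P).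
  have p0 : horner_mx (c%:M + v *m w) p = 0.
    rewrite rmorphM !rmorphB /= !horner_mx_C horner_mx_X.
    rewrite (addrC c%:M) addrK raddfD opprD addrA addrK -mulmxE mulmxBr.
    by rewrite outer_sqr mul_mx_scalar subrr.
  have := dvdp_leq _ (mxminpoly_min p0).
  rewrite size_Mmonic ?monicXsubC ?polyXsubC_eq0 // !size_XsubC; apply.
  by rewrite mulf_neq0 // polyXsubC_eq0.
have [a [b ab0]] : exists a b, (A - a%:M) *m (A - b%:M) = 0.
  have [a /factor_theorem[q pE]] : exists a, root (mxminpoly A) a.
    apply/closed_rootP.
    by rewrite size_mxminpoly eqSS -lt0n mxminpoly_nonconstant.
  have q0 : q != 0.
    by apply: contraTneq (mxminpoly_monic A) => q0; rewrite pE q0 mul0r monicE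
      lead_coef0 eq_sym oner_eq0.
  have szq : (size q <= 2)%N.
    by move: A_M1; rewrite /inM1 pE size_Mmonic ?monicXsubC // size_XsubC addn2.
  (* The cofactor [q] has degree at most 1. If it is constant, any [b] will do and 0 is taken;
     otherwise [b] is its root. *)
  have [b qb] : exists b, q %| 'X - b%:P.
    have [q1|/closed_rootP[b /factor_theorem[r qE]]] := eqVneq (size q) 1%N.
      exists 0; apply: (dvdp_trans _ (dvd1p _)).
      by rewrite dvdp1 q1.
    exists b; rewrite qE -[X in _ %| X]mul1r dvdp_mul // dvdp1.
    have r0 : r != 0 by apply: contraNneq q0 => r0; rewrite qE r0 mul0r.
    move: szq; rewrite qE size_Mmonic ?monicXsubC // size_XsubC addn2 /= ltnS.
    by rewrite leq_eqVlt ltnS leqn0 size_poly_eq0 (negPf r0) orbF.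
  exists b, a; have /mxminpoly_minP : mxminpoly A %| ('X - b%:P) * ('X - a%:P).
    by rewrite pE dvdp_mul.
  by rewrite rmorphM !rmorphB /= !horner_mx_C horner_mx_X.
have rank1 (B : 'M[C]_3) : (\rank B <= 1)%N ->
    exists (v : 'cV_3) (w : 'rV_3), B = v *m w.
  move: (col_base B) (row_base B) (mulmx_base B).
  case: (\rank B) => [|[|//]] v w <- _; last by exists v, w.
  by exists 0, 0; rewrite (thinmx0 v) !mul0mx.
have := mulmx0_rank_max ab0.
case: (leqP (\rank (A - a%:M)) 1) => [/rank1[v [w E]] _|ra rab].
  by exists a, v, w; rewrite -E addrC subrK.
have /rank1[v [w E]] : (\rank (A - b%:M)%R <= 1)%N by lia.
by exists b, v, w; rewrite -E addrC subrK.
Qed.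

Lemma trC_scalar (c : C) : \tr (c%:M : 'M_3) / 3%:R = c.
Proof. by rewrite mxtrace_scalar -[_ *+ 3]mulr_natr mulfK // natrC_neq0. Qed.

Lemma mxtrace_c1 A : \tr (c1 A) = 0.
Proof.
rewrite /c1 raddfB /= mxtrace_scalar -[_ *+ 3]mulr_natr.
by rewrite divfK ?subrr // natrC_neq0.
Qed.

Lemma c1_id A : \tr A = 0 -> c1 A = A.
Proof. by move=> trA; rewrite /c1 trA mul0r raddf0 subr0. Qed.

Lemma c1K A : c1 (c1 A) = c1 A.
Proof. exact/c1_id/mxtrace_c1. Qed.

Lemma c1_scalarD c A : c1 (c%:M + A) = c1 A.
Proof.
by rewrite /c1 raddfD mulrDl trC_scalar raddfD opprD addrACA subrr add0r.
Qed.

Lemma c1_decomp A : A = (d1 A / 3%:R)%:M + c1 A.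
Proof. by rewrite /c1 addrC subrK. Qed.

Lemma d1_scalarD t B : \tr B = 0 -> d1 ((t / 3%:R)%:M + B) = t.
Proof.
move=> trB; rewrite /d1 raddfD /= trB addr0 mxtrace_scalar -[_ *+ 3]mulr_natr.
by rewrite divfK // natrC_neq0.
Qed.

Lemma d2_c1 A : d2 (c1 A) = d2 A. Proof. by rewrite /d2 c1K. Qed.
Lemma d3_c1 A : d3 (c1 A) = d3 A. Proof. by rewrite /d3 c1K. Qed.
Lemma c2U_c1 A : c2U (c1 A) = c2U A. Proof. by rewrite /c2U c1K. Qed.

Lemma inord3_eq (i j : nat) : (i < 3)%N -> (j < 3)%N ->
  (inord i == inord j :> 'I_3) = (i == j).
Proof. by move=> i3 j3; rewrite -val_eqE /= !inordK. Qed.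

Lemma c1U_c1 A : c1U (c1 A) = c1U A.
Proof. by rewrite /c1U /c1 !mxE inord3_eq // subr0. Qed.

Lemma inM1_scalarD c A : inM1 (c%:M + A) = inM1 A.
Proof.
suff imp a B : inM1 B -> inM1 (a%:M + B).
  apply/idP/idP => [A_M1|]; last exact: imp.
  have <- : (- c)%:M + (c%:M + A) = A.
    by rewrite addrA -raddfD addNr raddf0 add0r.
  exact: imp A_M1.
move/inM1P => [b [v [w ->]]]; apply/inM1P; exists (a + b), v, w.
by rewrite addrA -raddfD.
Qed.

Lemma inN1_c1 A : inM1 A -> inN1 (c1 A).
Proof.
move=> A_M1; rewrite /inN1 mxtrace_c1 eqxx andbT.
by rewrite -(inM1_scalarD (d1 A / 3%:R)) -c1_decomp.
Qed.

Lemma inM1_c1P A : inM1 A -> exists (v : 'cV_3) (w : 'rV_3), c1 A = c1 (v *m w).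
Proof. by case/inM1P => c [v [w ->]]; exists v, w; rewrite c1_scalarD. Qed.

Lemma inN1P A : inN1 A -> exists (v : 'cV_3) (w : 'rV_3), A = c1 (v *m w).
Proof. by case/andP=> /inM1_c1P[v [w E]] /eqP/c1_id <-; exists v, w. Qed.

Lemma inN1_outer (v : 'cV_3) (w : 'rV_3) : inN1 (c1 (v *m w)).
Proof. by apply/inN1_c1/inM1P; exists 0, v, w; rewrite raddf0 add0r. Qed.

(* The values of z and D at the point c1 (v *m w) of N_1. *)
Definition zcoord (v : 'cV[C]_3) (w : 'rV[C]_3) : C := \tr (v *m w) / 3%:R.
Definition Dcoord (v : 'cV[C]_3) (w : 'rV[C]_3) : C :=
  v (inord 2) 0 * w 0 (inord 0).

Lemma zcoordE v w : zcoord v w =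
  (v (inord 0) 0 * w 0 (inord 0) + v (inord 1) 0 * w 0 (inord 1) +
   v (inord 2) 0 * w 0 (inord 2)) / 3%:R.
Proof. by rewrite /zcoord /mxtrace sum_ord3 !mxE !big_ord1. Qed.

Lemma outerE (R : pzSemiRingType) m n (v : 'cV[R]_m) (w : 'rV[R]_n) i j :
  (v *m w) i j = v i 0 * w 0 j.
Proof. by rewrite mxE big_ord1. Qed.

Section Outer.
Variables (v : 'cV[C]_3) (w : 'rV[C]_3).
Let z := zcoord v w.
Let M := v *m w.

Lemma c1_outer : c1 M = M - z%:M. Proof. by []. Qed.

Lemma c1_outerE i j : c1 M i j = v i 0 * w 0 j - z * (i == j)%:R.
Proof. by rewrite c1_outer mxE outerE !mxE mulr_natr. Qed.

(** Since M^2 = 3 z M, the square of M - z is 3 z M - 2 z M + z^2. *)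
Lemma c1_outer_sqr : c1 M *m c1 M = z *: M + (z ^+ 2)%:M.
Proof.
have trM : \tr M = 3%:R * z by rewrite /z /zcoord mulrC divfK // natrC_neq0.
rewrite c1_outer mulmxBl !mulmxBr outer_sqr mul_mx_scalar !mul_scalar_mx trM.
by apply/matrixP => i j; rewrite !mxE; case: (i == j); ring.
Qed.

Lemma d2_outer : d2 (c1 M) = z ^+ 2.
Proof.
have trM : \tr M = 3%:R * z by rewrite /z /zcoord mulrC divfK // natrC_neq0.
rewrite d2_c1 /d2 c1_outer_sqr raddfD /= mxtraceZ mxtrace_scalar trM.
apply: (mulIf (natrC_neq0 5)); rewrite divfK ?natrC_neq0 //; ring.
Qed.

Lemma c1U_outer : c1U (c1 M) = Dcoord v w.
Proof. by rewrite c1U_c1 /c1U /M !mxE big_ord1. Qed.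

Lemma c2U_outer : c2U (c1 M) = z * Dcoord v w.
Proof.
by rewrite c2U_c1 /c2U c1_outer_sqr !mxE big_ord1 inord3_eq // addr0.
Qed.

Lemma d3_outer : d3 (c1 M) = z ^+ 3.
Proof.
have tr3 : v (inord 0) 0 * w 0 (inord 0) + v (inord 1) 0 * w 0 (inord 1) +
    v (inord 2) 0 * w 0 (inord 2) = 3%:R * z.
  by rewrite /z zcoordE [RHS]mulrC divfK ?natrC_neq0.
rewrite d3_c1 /d3; apply: (mulIf (natrC_neq0 1)).
rewrite divfK ?natrC_neq0 // det_mx33 !c1_outerE !inord3_eq //=.
(* All 2 x 2 minors of the rank one matrix M vanish, so det (M - z) = z^2 (tr M - z). *)
transitivity (z ^+ 2 * (3%:R * z - z)); last by ring.
by rewrite -tr3; ring.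
Qed.

End Outer.

(** * Polynomial functions and unipotent invariance *)

Lemma unitri_unitmx (u : 'M_3) : unitri u -> u \in unitmx.
Proof.
case=> u1 u0; rewrite unitmxE det_mx33 !u1.
rewrite (u0 (inord 1) (inord 0)) ?(u0 (inord 2) _) ?inordK //.
by rewrite !(mulr0, mul0r, mulr1, subr0, addr0) unitr1.
Qed.

Section Conjugation.
Variables (u A : 'M[C]_3).
Hypothesis uU : u \in unitmx.
Let B := invmx u *m A *m u.

Lemma mxtrace_conj : \tr B = \tr A.
Proof. by rewrite mxtrace_mulC mulmxA mulmxV // mul1mx. Qed.

Lemma det_conj : \det B = \det A.
Proof. by rewrite !det_mulmx mulrAC -det_mulmx mulVmx // det1 mul1r. Qed.

Lemma c1_conj : c1 B = invmx u *m c1 A *m u.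
Proof.
rewrite /c1 mxtrace_conj mulmxBr mulmxBl mul_mx_scalar -scalemxAl.
by rewrite mulVmx // scalemx1.
Qed.
End Conjugation.

Lemma sqr_conj (u A : 'M[C]_3) : u \in unitmx ->
  (invmx u *m A *m u) *m (invmx u *m A *m u) = invmx u *m (A *m A) *m u.
Proof. by move=> uU; rewrite !mulmxA mulmxK. Qed.

Section UnipotentInvariance.
Variables (u A : 'M[C]_3).
Hypothesis ut : unitri u.
Let B := invmx u *m A *m u.
Let uU := unitri_unitmx ut.

Lemma d1_unitri : d1 B = d1 A. Proof. exact: mxtrace_conj. Qed.

Lemma d2_unitri : d2 B = d2 A.
Proof. by rewrite /d2 c1_conj // sqr_conj // mxtrace_conj. Qed.

Lemma d3_unitri : d3 B = d3 A.
Proof. by rewrite /d3 c1_conj // det_conj. Qed.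

(** Compare the (3,1) entries of u B = A u: the last row of u and its first column are standard
    basis vectors. *)
Lemma c1U_unitri : c1U B = c1U A.
Proof.
have : (u *m B) (inord 2) (inord 0) = (A *m u) (inord 2) (inord 0).
  by rewrite /B -mulmxA mulKVmx.
rewrite !mxE !sum_ord3; case: ut => u1 u0.
rewrite !u1 !(u0 (inord 2)) ?(u0 (inord 1) (inord 0)) ?inordK //.
by rewrite !(mul0r, mulr0, mulr1, mul1r, addr0, add0r).
Qed.
End UnipotentInvariance.

Lemma c2U_unitri (u A : 'M[C]_3) : unitri u -> c2U (invmx u *m A *m u) = c2U A.
Proof.
move=> ut; have uU := unitri_unitmx ut.
rewrite /c2U c1_conj // sqr_conj //; exact: c1U_unitri.
Qed.

Lemma polyfun_cst (c : C) : polyfun (fun=> c).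
Proof. by exists c%:MP => A; rewrite mevalC. Qed.

Lemma polyfun_entry i j : polyfun (fun A => A i j).
Proof.
exists 'X_(inord (3 * i + j)) => A; rewrite mevalXU /mxcoords.
have lt_ij : (3 * i + j < 9)%N by have := ltn_ord i; have := ltn_ord j; lia.
rewrite inordK // mulnC divnMDl // divn_small ?ltn_ord // addn0.
by rewrite modnMDl modn_small ?ltn_ord // !inord_val.
Qed.

Lemma polyfun_ext f g : f =1 g -> polyfun f -> polyfun g.
Proof. by move=> fg [p fE]; exists p => A; rewrite -fg. Qed.

Lemma polyfunD f g : polyfun f -> polyfun g -> polyfun (fun A => f A + g A).
Proof. by move=> [p fE] [q gE]; exists (p + q) => A; rewrite mevalD fE gE. Qed.

Lemma polyfunM f g : polyfun f -> polyfun g -> polyfun (fun A => f A * g A).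
Proof. by move=> [p fE] [q gE]; exists (p * q) => A; rewrite mevalM fE gE. Qed.

Lemma polyfunB f g : polyfun f -> polyfun g -> polyfun (fun A => f A - g A).
Proof. by move=> [p fE] [q gE]; exists (p - q) => A; rewrite mevalB fE gE. Qed.

Lemma polyfun_sum (I : Type) (r : seq I) (F : I -> 'M[C]_3 -> C) :
  (forall i, polyfun (F i)) -> polyfun (fun A => \sum_(i <- r) F i A).
Proof.
move=> FP; elim: r => [|i r IHr].
  by apply: polyfun_ext (polyfun_cst 0) => A; rewrite big_nil.
by apply: polyfun_ext (polyfunD (FP i) IHr) => A; rewrite big_cons.
Qed.

Lemma polyfun_comp f (F : 'M[C]_3 -> 'M[C]_3) :
  polyfun f -> (forall i j, polyfun (fun A => F A i j)) -> polyfun (f \o F).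
Proof.
move=> [p fE] FP.
have /fin_all_exists[q qE] (k : 'I_9) : exists q : {mpoly C[9]},
    forall A, mxcoords (F A) k = q.@[mxcoords A] by apply: FP.
exists (p \mPo [tuple q i | i < 9]) => A; rewrite comp_mpoly_meval /= fE.
by apply: meval_eq => k; rewrite tnth_mktuple -qE.
Qed.

Lemma polyfun_meval n (p : {mpoly C[n]}) (F : 'I_n -> 'M[C]_3 -> C) :
  (forall i, polyfun (F i)) -> polyfun (fun A => p.@[F^~ A]).
Proof.
move=> /fin_all_exists[q qE]; exists (p \mPo [tuple q i | i < n]) => A.
by rewrite comp_mpoly_meval; apply: meval_eq => k; rewrite tnth_mktuple qE.
Qed.

Lemma polyfun_mul_entry (F G : 'M[C]_3 -> 'M[C]_3) :
  (forall i j, polyfun (fun A => F A i j)) ->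
  (forall i j, polyfun (fun A => G A i j)) ->
  forall i j, polyfun (fun A => (F A *m G A) i j).
Proof.
move=> FP GP i j.
have := polyfun_sum (index_enum 'I_3) (fun k => polyfunM (FP i k) (GP k j)).
by apply: polyfun_ext => A; rewrite mxE.
Qed.

Lemma polyfun_tr (F : 'M[C]_3 -> 'M[C]_3) :
  (forall i j, polyfun (fun A => F A i j)) -> polyfun (fun A => \tr (F A)).
Proof. by move=> FP; apply: polyfun_sum => i. Qed.

Lemma polyfun_c1 i j : polyfun (fun A => c1 A i j).
Proof.
have tP := polyfunM (polyfun_tr polyfun_entry)
  (polyfun_cst (3%:R^-1 *+ (i == j))).
apply: polyfun_ext (polyfunB (polyfun_entry i j) tP) => A.
by rewrite !mxE mulrnAr.
Qed.

Lemma polyfun_d1 : polyfun d1.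
Proof. exact: polyfun_tr polyfun_entry. Qed.

Lemma polyfun_d2 : polyfun d2.
Proof.
have P2 := polyfun_mul_entry polyfun_c1 polyfun_c1.
exact: polyfunM (polyfun_tr P2) (polyfun_cst _).
Qed.

Lemma polyfun_d3 : polyfun d3.
Proof.
have detP : polyfun (fun A => \det A).
  pose e i j := polyfun_entry (inord i) (inord j).
  pose P2 i j k l := polyfunM (e i j) (e k l).
  pose P3 i j k l m n o p q r :=
    polyfunM (e i j) (polyfunB (P2 k l m n) (P2 o p q r)).
  apply: (polyfun_ext _ (polyfunD
    (polyfunB (P3 0 0 1 1 2 2 1 2 2 1) (P3 0 1 1 0 2 2 1 2 2 0))
    (P3 0 2 1 0 2 1 1 1 2 0))) => A; exact/esym/det_mx33.
exact: polyfunM (polyfun_comp detP polyfun_c1) (polyfun_cst _).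
Qed.

Lemma polyfun_c1U : polyfun c1U. Proof. exact: polyfun_entry. Qed.

Lemma polyfun_c2U : polyfun c2U.
Proof. exact: (polyfun_mul_entry polyfun_c1 polyfun_c1). Qed.

Lemma coordU_d1 X : coordU X d1.
Proof. by split=> [|u ut A _]; [exact: polyfun_d1|exact: d1_unitri]. Qed.

Lemma coordU_d2 X : coordU X d2.
Proof. by split=> [|u ut A _]; [exact: polyfun_d2|exact: d2_unitri]. Qed.

Lemma coordU_d3 X : coordU X d3.
Proof. by split=> [|u ut A _]; [exact: polyfun_d3|exact: d3_unitri]. Qed.

Lemma coordU_c1U X : coordU X c1U.
Proof. by split=> [|u ut A _]; [exact: polyfun_c1U|exact: c1U_unitri]. Qed.

Lemma coordU_c2U X : coordU X c2U.
Proof. by split=> [|u ut A _]; [exact: polyfun_c2U|exact: c2U_unitri]. Qed.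

Lemma coordU_meval X n (p : {mpoly C[n]}) (F : 'I_n -> 'M[C]_3 -> C) :
  (forall i, coordU X (F i)) -> coordU X (fun A => p.@[F^~ A]).
Proof.
move=> FX; split=> [|u ut A XA].
  by apply: polyfun_meval => i; case: (FX i).
by apply: meval_eq => i; apply: (FX i).2.
Qed.

(** The projection [c1] is polynomial, maps M_1 to N_1 and commutes with conjugation. *)
Lemma coordU_c1 g : coordU inN1 g -> coordU inM1 (fun A => g (c1 A)).
Proof.
case=> gP gU; split=> [|u ut A A_M1]; first exact: polyfun_comp gP polyfun_c1.
by rewrite c1_conj ?unitri_unitmx // gU // inN1_c1.
Qed.

(** * Invariants on N_1 are polynomials in z and D *)

(** The column e_3 times the row (D, 0, 3z): after [c1], this gives a slice for the U-action on the
    part of N_1 where D is nonzero. The factor 3 compensates for the division in [zcoord]. *)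
Definition section_col : 'cV[C]_3 := delta_mx (inord 2) 0.
Definition section_row (z D : C) : 'rV[C]_3 :=
  D *: delta_mx 0 (inord 0) + (3%:R * z) *: delta_mx 0 (inord 2).

Lemma zcoord_section z D : zcoord section_col (section_row z D) = z.
Proof.
rewrite zcoordE !mxE !inord3_eq //= ?eqxx /=.
rewrite !(mul0r, mul1r, add0r, mulr0, mulr1).
by rewrite mulrC mulKf // natrC_neq0.
Qed.

Lemma Dcoord_section z D : Dcoord section_col (section_row z D) = D.
Proof.
by rewrite /Dcoord !mxE !inord3_eq //= ?eqxx /= !(mul1r, addr0, mulr0, mulr1).
Qed.

Lemma outer_conj_section (v : 'cV[C]_3) (w : 'rV[C]_3) : Dcoord v w != 0 ->
  exists2 u, unitri u & invmx u *m c1 (v *m w) *m u =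
    c1 (section_col *m section_row (zcoord v w) (Dcoord v w)).
Proof.
rewrite mulf_eq0 negb_or => /andP[v2 w0].
(* The third column of [u] is v / v_3, so u maps v_3 e_3 to v. The (1,2) entry makes the middle
   entry of w u vanish. The scalar v_3 is then moved from the column to the row, whose last entry
   becomes tr (v w) = 3z. *)
pose u : 'M[C]_3 := \matrix_(i, j) match (i : nat), (j : nat) with
  | 0%N, 0%N | 1%N, 1%N | 2%N, 2%N => 1
  | 0%N, 1%N => - (w 0 (inord 1) / w 0 (inord 0))
  | 0%N, 2%N => v (inord 0) 0 / v (inord 2) 0
  | 1%N, 2%N => v (inord 1) 0 / v (inord 2) 0
  | _, _ => 0 end.
have ut : unitri u.
  split; first by elim/ord3P; rewrite !mxE !inordK.
  by elim/ord3P; elim/ord3P; rewrite !mxE !inordK.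
have uv : u *m (v (inord 2) 0 *: section_col) = v.
  apply/matrixP => i j; rewrite (ord1 j) -scalemxAr !mxE sum_ord3.
  rewrite !mxE !inord3_eq //= ?eqxx /= !mulr0 !add0r mulr1.
  by elim/ord3P: i; rewrite ?inordK //= ?mulr1 // mulrC divfK.
have wu : v (inord 2) 0 *: (w *m u) = section_row (zcoord v w) (Dcoord v w).
  apply/matrixP => i j; rewrite (ord1 i) !mxE sum_ord3 !mxE zcoordE /Dcoord.
  rewrite !inordK // (mulrC 3%:R) divfK ?natrC_neq0 //.
  elim/ord3P: j; rewrite ?inordK // ?inord3_eq //= ?eqxx.
  - by rewrite !mulr0 !addr0 !mulr1.
  - rewrite !mulr0 !addr0 mulr1 mulrN [w 0 _ * (_ / _)]mulrC divfK //.
    by rewrite addNr mulr0.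
  - by rewrite mulr0 add0r !mulr1; field.
exists u => //; have uU := unitri_unitmx ut.
rewrite -c1_conj // !mulmxA -{1}uv mulKmx // -!scalemxAl -mulmxA -wu.
by rewrite -scalemxAr.
Qed.

Definition polyfun1 (g : C -> C) := exists h : {poly C}, forall t, g t = h.[t].

Lemma polyfun1_cst c : polyfun1 (fun=> c).
Proof. by exists c%:P => t; rewrite hornerC. Qed.

Lemma polyfun1_id : polyfun1 id.
Proof. by exists 'X => t; rewrite hornerX. Qed.

Lemma polyfun1D f g : polyfun1 f -> polyfun1 g -> polyfun1 (fun t => f t + g t).
Proof. by move=> [p fE] [q gE]; exists (p + q) => t; rewrite hornerD fE gE. Qed.

Lemma polyfun1B f g : polyfun1 f -> polyfun1 g -> polyfun1 (fun t => f t - g t).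
Proof.
by move=> [p fE] [q gE]; exists (p - q) => t; rewrite hornerD hornerN fE gE.
Qed.

Lemma polyfun1M f g : polyfun1 f -> polyfun1 g -> polyfun1 (fun t => f t * g t).
Proof. by move=> [p fE] [q gE]; exists (p * q) => t; rewrite hornerM fE gE. Qed.

Lemma polyfun1_meval n (p : {mpoly C[n]}) (F : 'I_n -> C -> C) :
  (forall i, polyfun1 (F i)) -> polyfun1 (fun t => p.@[F^~ t]).
Proof.
move=> /fin_all_exists[h hE]; exists (mmap polyC h p) => t.
by rewrite horner_mmap_polyC; apply: meval_eq => i; rewrite hE.
Qed.

(** The density argument on a line: C[t] is an integral domain, so an identity that holds wherever f
    is nonzero holds everywhere. *)
Lemma polyfun1_cancel f g : polyfun1 f -> polyfun1 g -> (exists t, f t != 0) ->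
  (forall t, f t * g t = 0) -> forall t, g t = 0.
Proof.
move=> [p fE] [q gE] [t ft] fg0.
have /eqP : p * q = 0 by apply: poly_eval0 => s; rewrite hornerM -fE -gE.
rewrite mulf_eq0 => /orP[/eqP p0|/eqP q0] s; last by rewrite gE q0 horner0.
by rewrite fE p0 horner0 eqxx in ft.
Qed.

Definition zD (z D : C) : 'I_2 -> C := tnth [tuple z; D].

(* Every U-orbit in {D != 0} meets the section in one point, so f is a
   polynomial in z and D there; the complement is reached by moving along the
   line (v + t e_3, w + t e_1). *)
Lemma coordU_inN1_zD f : coordU inN1 f -> exists P : {mpoly C[2]},
  forall v w, f (c1 (v *m w)) = P.@[zD (zcoord v w) (Dcoord v w)].
Proof.
move=> [[p fE] fU].
(* The entries of the slice matrix as polynomials in z and D; thus [P] is the restriction of f to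
   the slice. *)
pose q (k : 'I_9) : {mpoly C[2]} :=
  let i := inord (k %/ 3) : 'I_3 in let j := inord (k %% 3) in
  (section_col i 0)%:MP
      * ((j == inord 0)%:R *: DD + (3%:R * (j == inord 2)%:R) *: zz)
    - (i == j)%:R *: zz.
pose P := p \mPo [tuple q k | k < 9].
have PE z D : f (c1 (section_col *m section_row z D)) = P.@[zD z D].
  rewrite comp_mpoly_meval fE; apply: meval_eq => k.
  rewrite tnth_mktuple /mxcoords c1_outerE zcoord_section /q.
  move: (inord _) (inord _) => i j.
  rewrite mevalB mevalM mevalC mevalD !mevalZ !mevalXU /zD !(tnth_nth 0).
  rewrite !inordK //=.
  by congr (_ * _ - _); [rewrite !mxE; ring | rewrite mulrC].
have PD v w : Dcoord v w != 0 ->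
    f (c1 (v *m w)) = P.@[zD (zcoord v w) (Dcoord v w)].
  move=> D0; have [u ut uE] := outer_conj_section D0.
  by rewrite -PE -uE fU // inN1_outer.
exists P => v w.
pose vt t := v + t *: section_col.
pose wt t := w + t *: delta_mx 0 (inord 0).
have vtP i : polyfun1 (fun t => vt t i 0).
  have [h hE] := polyfun1D (polyfun1_cst (v i 0))
    (polyfun1M polyfun1_id (polyfun1_cst (section_col i 0))).
  by exists h => t; rewrite -hE !mxE.
have wtP j : polyfun1 (fun t => wt t 0 j).
  have [h hE] := polyfun1D (polyfun1_cst (w 0 j))
    (polyfun1M polyfun1_id (polyfun1_cst ((delta_mx 0 (inord 0) : 'rV_3) 0 j))).
  by exists h => t; rewrite -hE !mxE.
have zP : polyfun1 (fun t => zcoord (vt t) (wt t)).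
  have e i := polyfun1M (vtP i) (wtP i).
  have [h hE] := polyfun1M
    (polyfun1D (polyfun1D (e (inord 0)) (e (inord 1))) (e (inord 2)))
    (polyfun1_cst 3%:R^-1).
  by exists h => t; rewrite -hE zcoordE.
have DP : polyfun1 (fun t => Dcoord (vt t) (wt t)) by apply: polyfun1M.
have fP : polyfun1 (fun t => f (c1 (vt t *m wt t))).
  have e k := polyfun1B
    (polyfun1M (vtP (inord (k %/ 3))) (wtP (inord (k %% 3))))
    (polyfun1M zP (polyfun1_cst (inord (k %/ 3) == inord (k %% 3) :> 'I_3)%:R)).
  have [h hE] := polyfun1_meval p e.
  exists h => t; rewrite -hE fE; apply: meval_eq => k.
  by rewrite /mxcoords c1_outerE.
pose zDt t := zD (zcoord (vt t) (wt t)) (Dcoord (vt t) (wt t)).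
have PP : polyfun1 (fun t => P.@[zDt t]).
  apply: (@polyfun1_meval _ P (fun i t => zDt t i)) => i.
  by rewrite /zDt /zD; case: i => [[|[|//]] i2].
have D0 : exists t, Dcoord (vt t) (wt t) != 0.
  (* Along the line, D equals (t + v_3)(t + w_1), which is not the zero polynomial. *)
  pose q1 := ('X + (v (inord 2) 0)%:P) * ('X + (w 0 (inord 0))%:P).
  have q1E t : Dcoord (vt t) (wt t) = q1.[t].
    rewrite /Dcoord !mxE !eqxx !mulr1 hornerM !hornerD !hornerX !hornerC.
    by rewrite ![t + _]addrC.
  have [|t] := closed_nonrootP q1 _.
    by rewrite mulf_neq0 // -size_poly_eq0 size_XaddC.
  by exists t; rewrite q1E.
(* D times the difference of both sides vanishes along the whole line; after cancelling D, the claim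
   is the case t = 0. *)
have := polyfun1_cancel DP (polyfun1B fP PP) D0.
have -> : v = vt 0 by rewrite /vt scale0r addr0.
have -> : w = wt 0 by rewrite /wt scale0r addr0.
move=> /(_ _ 0)/eqP; rewrite subr_eq0 => e; apply/eqP/e => t.
have [->|/PD ->] := eqVneq (Dcoord (vt t) (wt t)) 0; first by rewrite mul0r.
by rewrite subrr mulr0.
Qed.

Lemma poly_eq_eval (F : closedFieldType) (p q : {poly F}) :
  (forall t, p.[t] = q.[t]) -> p = q.
Proof.
by move=> pq; apply/eqP; rewrite -subr_eq0; apply/eqP/poly_eval0 => t;
   rewrite hornerD hornerN pq subrr.
Qed.

(** The chain rule at t = 0 for p along the polynomial curve h. *)
Lemma coef1_mmap_polyC n (R : comNzRingType) (h : 'I_n -> {poly R}) p :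
  (mmap polyC h p)`_1 = \sum_k (p^`M(k)).@[fun i => (h i)`_0] * (h k)`_1.
Proof.
have coef0 q : (mmap polyC h q)`_0 = q.@[fun i => (h i)`_0].
  rewrite -horner_coef0 horner_mmap_polyC.
  by apply: meval_eq => i; rewrite horner_coef0.
elim/mpoly_ring_ind: p => [c|i|p q IHp IHq|p q IHp IHq].
- rewrite mmapC coefC big1 // => k _.
  by rewrite mderivC meval0 mul0r.
- rewrite mmapX mmap1U (bigD1 i) //= big1 => [|k ki].
    rewrite mderivX mnm1E eqxx.
    have -> : (U_(i) - U_(i))%MM = 0%MM.
      by apply/mnmP => j; rewrite mnmBE subnn mnm0E.
    by rewrite scale1r mpolyX0 meval1 mul1r addr0.
  by rewrite mderivX mnm1E eq_sym (negPf ki) scale0r meval0 mul0r.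
- rewrite rmorphD coefD IHp IHq -big_split; apply: eq_bigr => k _.
  by rewrite mderivD mevalD mulrDl.
- rewrite rmorphM coefM !big_ord_recl big_ord0 addr0 /= !coef0 IHp IHq.
  rewrite mulr_sumr mulr_suml -big_split; apply: eq_bigr => k _ /=.
  by rewrite mderivM mevalD !mevalM; ring.
Qed.

Lemma comp_mpolyM n k (R : comNzRingType) (lq : n.-tuple {mpoly R[k]}) :
  {morph comp_mpoly lq : p q / p * q}.
Proof. exact: rmorphM. Qed.

Lemma comp_subalg_gensX :
  ('X_(inord 0) \mPo subalg_gens = zz ^+ 2)
  * ('X_(inord 1) \mPo subalg_gens = zz ^+ 3)
  * ('X_(inord 2) \mPo subalg_gens = DD)
  * ('X_(inord 3) \mPo subalg_gens = zz * DD).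
Proof. by rewrite !comp_mpolyXU !inordK. Qed.

(** Among the monomials z^i D^j, only z itself is not a product of generators, so the subalgebra
    together with the line spanned by z is everything. *)
Lemma subalg_split (P : {mpoly C[2]}) :
  exists q a, P = q \mPo subalg_gens + a *: zz.
Proof.
have mon i j : exists q a, zz ^+ i * DD ^+ j = q \mPo subalg_gens + a *: zz.
  have mulD r : (exists q a, r = q \mPo subalg_gens + a *: zz) ->
      exists q a, DD * r = q \mPo subalg_gens + a *: zz.
    (* Multiplication by D turns the exceptional term a z into a multiple of the generator zD;
       below, multiplication by z^2 turns it into a multiple of z^3. *)
    move=> [q [a ->]]; exists ('X_(inord 2) * q + a *: 'X_(inord 3)), 0.
    rewrite [0 *: _]scale0r [RHS]addr0 comp_mpolyD comp_mpolyM comp_mpolyZ.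
    rewrite !comp_subalg_gensX.
    move: (q \mPo _) zz DD => Q z D.
    by rewrite mulrDr -scalerAr (mulrC D z).
  elim: j => [|j IHj]; last by rewrite exprS mulrCA; apply: mulD.
  rewrite expr0 mulr1; elim/ltn_ind: i => -[|[|i]] IHi.
  - by exists 1, 0; rewrite comp_mpoly1 [0 *: _]scale0r [RHS]addr0.
  - by exists 0, 1; rewrite comp_mpoly0 scale1r add0r.
  - have [|q [a E]] := IHi i; first by lia.
    exists ('X_(inord 0) * q + a *: 'X_(inord 1)), 0.
    rewrite [0 *: _]scale0r [RHS]addr0 comp_mpolyD comp_mpolyM comp_mpolyZ.
    rewrite !comp_subalg_gensX.
    move: (q \mPo _) zz E => Q z E.
    by rewrite -[i.+2]add2n exprD E mulrDr -scalerAr -exprSr.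
elim/mpolyind: P => [|c m P _ _ [q [a ->]]].
  by exists 0, 0; rewrite comp_mpoly0 [0 *: _]scale0r [RHS]addr0.
have -> : 'X_[m] = zz ^+ m (inord 0) * DD ^+ m (inord 1).
  have i0 : inord 0 = ord0 :> 'I_2 by apply/val_inj; rewrite /= inordK.
  have i1 : inord 1 = lift ord0 ord0 :> 'I_2.
    by apply/val_inj; rewrite /= inordK.
  by rewrite mpolyXE_id !big_ord_recl big_ord0 mulr1 /zz /DD i0 i1.
have [q' [a' ->]] := mon (m (inord 0)) (m (inord 1)).
exists (c *: q' + q), (c * a' + a).
by rewrite comp_mpolyD comp_mpolyZ scalerDr scalerDl scalerA addrACA.
Qed.

Lemma meval_subalg_gens (q : {mpoly C[4]}) z D :
  (q \mPo subalg_gens).@[zD z D] = q.@[tnth [tuple z ^+ 2; z ^+ 3; D; z * D]].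
Proof.
rewrite comp_mpoly_meval; apply: meval_eq => -[[|[|[|[|//]]]] i4];
by rewrite !(tnth_nth 0) /= ?(rmorphM (meval _)) ?(rmorphXn (meval _)) /=
  !mevalXU /zD !(tnth_nth 0) !inordK.
Qed.

Definition gensN1 (A : 'M[C]_3) : 'I_4 -> C :=
  tnth [tuple d2 A; d3 A; c1U A; c2U A].

Lemma gensN1_outer v w : gensN1 (c1 (v *m w)) =1
  tnth [tuple (zcoord v w) ^+ 2; (zcoord v w) ^+ 3; Dcoord v w;
    zcoord v w * Dcoord v w].
Proof. by rewrite /gensN1 d2_outer d3_outer c1U_outer c2U_outer. Qed.

Lemma meval_gensN1 (q : {mpoly C[4]}) v w : q.@[gensN1 (c1 (v *m w))] =
  (q \mPo subalg_gens).@[zD (zcoord v w) (Dcoord v w)].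
Proof. by rewrite meval_subalg_gens; apply/meval_eq/gensN1_outer. Qed.

(* The monomial z is excluded: the linear part of f at 0 is a linear form l on
   matrices, and if z occurred in f with coefficient a, then l would take the
   value a at each of the three diagonal matrices 3 E_ii - I, which sum to 0. *)
Lemma coordU_inN1_gens f : coordU inN1 f -> exists q : {mpoly C[4]},
  eqon inN1 f (fun A => q.@[gensN1 A]).
Proof.
move=> fN1; have [P PE] := coordU_inN1_zD fN1; have [[p fE] _] := fN1.
have [q [a Pqa]] := subalg_split P; suff a0 : a = 0.
  exists q => A /inN1P[v [w ->]].
  by rewrite PE meval_gensN1 Pqa a0 scale0r addr0.
(* [S] is f along the curve z = t, D = 0, and its linear coefficient is [a]. The vectors [e i] list
   the entries of 3 E_ii - I, so t times such a matrix is a point of this curve for each of the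
   three [i]. *)
pose S := mmap polyC (tnth [tuple 'X^2; 'X^3; 0; 0]) q + a *: 'X.
pose e (i : 'I_3) (k : 'I_9) : C :=
  let j := inord (k %/ 3) in let l := inord (k %% 3) in
  3%:R * (j == i)%:R * (l == i)%:R - (j == l)%:R.
have SE i : mmap polyC (fun k => e i k *: 'X) p = S.
  apply: poly_eq_eval => t.
  pose v : 'cV[C]_3 := t *: delta_mx i 0.
  pose w : 'rV[C]_3 := 3%:R *: delta_mx 0 i.
  have zt : zcoord v w = t.
    rewrite /zcoord mxtrace_mulC -scalemxAl -scalemxAr mul_delta_mx.
    rewrite scalerA mxtraceZ [\tr _]big_ord1 mxE !eqxx mulr1 mulrAC.
    by rewrite divff ?mul1r // natrC_neq0.
  have D0 : Dcoord v w = 0.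
    rewrite /Dcoord !mxE !eqxx andbT /=; have [<-|_] := eqVneq (inord 2) i.
      by rewrite inord3_eq // !mulr0.
    by rewrite mulr0 mul0r.
  transitivity (f (c1 (v *m w))).
    rewrite horner_mmap_polyC fE; apply: meval_eq => k.
    rewrite hornerZ hornerX /mxcoords c1_outerE zt !mxE !eqxx andbT /= /e.
    ring.
  rewrite PE zt D0 Pqa mevalD meval_subalg_gens mevalZ mevalXU.
  rewrite hornerD hornerZ hornerX horner_mmap_polyC; congr (_ + _).
    apply: meval_eq => -[[|[|[|[|//]]]] i4]; rewrite !(tnth_nth 0) /=;
    by rewrite ?hornerXn ?horner0 ?mulr0.
  by rewrite /zD (tnth_nth 0) inordK.
have S1 : S`_1 = a.
  rewrite coefD coefZ coefX mulr1 coef1_mmap_polyC big1 ?add0r // => k _.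
  case: k => [[|[|[|[|//]]]] i4]; rewrite (tnth_nth 0 _ (Ordinal i4)) /=;
  by rewrite ?coefXn ?coef0 mulr0.
have : a *+ 3 = 0.
  transitivity (\sum_(i < 3) S`_1); first by rewrite S1 sumr_const card_ord.
  rewrite -(eq_bigr _ (fun i _ => congr1 (coefp 1) (SE i))) /=.
  under eq_bigr => i _ do rewrite coef1_mmap_polyC.
  rewrite exchange_big big1 // => k _ /=.
  under eq_bigr => i _.
    rewrite (meval_eq (v2 := fun=> 0)); last first.
      by move=> l; rewrite coefZ coefX mulr0.
    rewrite coefZ coefX mulr1; over.
  rewrite -mulr_sumr sum_ord3 /e.
  set j := inord (k %/ 3); set l := inord (k %% 3).
  rewrite -[RHS](mulr0 (p^`M(k)).@[fun=> 0]); congr (_ * _).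
  by elim/ord3P: (j : 'I_3); elim/ord3P: (l : 'I_3);
    rewrite !inord3_eq //=; ring.
by move/eqP; rewrite -mulr_natr mulf_eq0 (negPf (natrC_neq0 2)) orbF => /eqP.
Qed.

(** * The subalgebra generated by z^2, z^3, D, zD *)

Lemma in_subalgD p q : in_subalg p -> in_subalg q -> in_subalg (p + q).
Proof. by move=> [a ->] [b ->]; exists (a + b); rewrite comp_mpolyD. Qed.

Lemma in_subalgM p q : in_subalg p -> in_subalg q -> in_subalg (p * q).
Proof. by move=> [a ->] [b ->]; exists (a * b); rewrite comp_mpolyM. Qed.

Lemma in_subalgZ c p : in_subalg p -> in_subalg (c *: p).
Proof. by move=> [a ->]; exists (c *: a); rewrite comp_mpolyZ. Qed.

Lemma in_subalg1 : in_subalg 1.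
Proof. by exists 1; rewrite comp_mpoly1. Qed.

Lemma in_subalg_gens : [/\ in_subalg (zz ^+ 2), in_subalg (zz ^+ 3),
  in_subalg DD & in_subalg (zz * DD)].
Proof.
by split; [exists 'X_(inord 0)|exists 'X_(inord 1)|exists 'X_(inord 2)
  |exists 'X_(inord 3)]; rewrite comp_subalg_gensX.
Qed.

(** A chosen expression of p in the four generators, with 0 as default outside the subalgebra. Two
    expressions of the same p may differ, but they agree as functions on N_1. *)
Definition subalg_rep (p : {mpoly C[2]}) : {mpoly C[4]} :=
  match excluded_middle_informative (in_subalg p) with
  | left p_sub => proj1_sig (constructive_indefinite_description _ p_sub)
  | right _ => 0
  end.

Lemma subalg_repP p : in_subalg p -> subalg_rep p \mPo subalg_gens = p.
Proof.
rewrite /subalg_rep; case: excluded_middle_informative => // p_sub _.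
by case: constructive_indefinite_description.
Qed.

Definition eta (p : {mpoly C[2]}) (A : 'M[C]_3) : C :=
  (subalg_rep p).@[gensN1 A].

(** This makes [eta] independent of the chosen expression on N_1, and reduces its algebra laws to
    those of evaluation at (z, D). *)
Lemma eta_outer p v w : in_subalg p ->
  eta p (c1 (v *m w)) = p.@[zD (zcoord v w) (Dcoord v w)].
Proof. by move=> sp; rewrite /eta meval_gensN1 subalg_repP. Qed.

Lemma coordU_gensN1 X q : coordU X (fun A => q.@[gensN1 A]).
Proof.
apply: (@coordU_meval X 4 q (fun i A => gensN1 A i)) => i; rewrite /gensN1.
case: i => [[|[|[|[|//]]]] i4].
- exact: coordU_d2.
- exact: coordU_d3.
- exact: coordU_c1U.
- exact: coordU_c2U.
Qed.

(** The slice realizes every pair (z, D), so p and q agree at all points of the plane. *)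
Lemma eta_inj p q : in_subalg p -> in_subalg q ->
  eqon inN1 (eta p) (eta q) -> p = q.
Proof.
move=> sp sq pq; apply: mpoly_eq_eval => x.
have xE : x =1 zD (x (inord 0)) (x (inord 1)).
  case=> [[|[|//]] i2]; rewrite /zD (tnth_nth 0) /=;
  by congr x; apply/val_inj; rewrite /= inordK.
have := pq _ (inN1_outer section_col (section_row (x (inord 0)) (x (inord 1)))).
by rewrite !eta_outer // zcoord_section Dcoord_section -!(meval_eq _ xE).
Qed.

(** * Expansion of invariants in powers of the trace *)

Definition taylor_d1 (p : {mpoly C[9]}) (B : 'M[C]_3) : {poly C} :=
  mmap polyC (fun k => (mxcoords B k)%:P + (mxcoords (3%:R^-1)%:M k) *: 'X) p.

Lemma horner_taylor_d1 p B t :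
  (taylor_d1 p B).[t] = p.@[mxcoords ((t / 3%:R)%:M + B)].
Proof.
rewrite horner_mmap_polyC; apply: meval_eq => k.
rewrite hornerD hornerC hornerZ hornerX /mxcoords !mxE addrC; congr (_ + _).
by rewrite mulrnAl mulrC.
Qed.

Lemma polyfun_coef_taylor_d1 p k : polyfun (fun B => (taylor_d1 p B)`_k).
Proof.
elim/mpoly_ring_ind: p k => [c|i|p q IHp IHq|p q IHp IHq] k.
- apply: polyfun_ext (polyfun_cst (c%:P)`_k) => B.
  by rewrite /taylor_d1 mmapC.
- apply: polyfun_ext (polyfunD
    (polyfunM (polyfun_entry (inord (i %/ 3)) (inord (i %% 3)))
      (polyfun_cst (k == 0)%:R))
    (polyfun_cst ((mxcoords (3%:R^-1)%:M i) *: 'X : {poly C})`_k)) => B.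
  rewrite /taylor_d1 mmapX mmap1U coefD coefC; congr (_ + _).
  by case: (k == 0)%N; rewrite ?mulr1 ?mulr0.
- apply: polyfun_ext (polyfunD (IHp k) (IHq k)) => B.
  by rewrite /taylor_d1 rmorphD coefD.
- have := polyfun_sum (index_enum 'I_k.+1)
    (fun j => polyfunM (IHp j) (IHq (k - j)%N)).
  by apply: polyfun_ext => B; rewrite /taylor_d1 rmorphM coefM.
Qed.

(** A degree bound uniform in [B] is what gives the expansion a fixed number of terms. *)
Lemma size_taylor_d1 p : exists n, forall B, (size (taylor_d1 p B) <= n)%N.
Proof.
elim/mpoly_ring_ind: p => [c|i|p q [n pn] [m qm]|p q [n pn] [m qm]].
- by exists 1%N => B; rewrite /taylor_d1 mmapC size_polyC_leq1.
- exists 2%N => B; rewrite /taylor_d1 mmapX mmap1U.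
  rewrite (leq_trans (size_polyD _ _)) // geq_max.
  rewrite (leq_trans (size_polyC_leq1 _)) //.
  by rewrite (leq_trans (size_scale_leq _ _)) // size_polyX.
- exists (maxn n m) => B; rewrite /taylor_d1 rmorphD.
  by rewrite (leq_trans (size_polyD _ _)) // geq_max !leq_max pn qm orbT.
- exists (n + m)%N => B; rewrite /taylor_d1 rmorphM.
  rewrite (leq_trans (size_polyMleq _ _)) // (leq_trans (leq_pred _)) //.
  by rewrite leq_add ?pn ?qm.
Qed.

(** Write A as (tr A / 3) I + c1 A and expand f in the trace. Conjugation fixes scalar matrices, so
    for B in N_1 the polynomials t -> f((t/3) I + B) at B and at its conjugate coincide; hence each
    coefficient is invariant. *)
Lemma coordU_inM1_expand f : coordU inM1 f ->
  exists (n : nat) (g : nat -> Mat -> C),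
  (forall k, coordU inN1 (g k)) /\
  eqon inM1 f (fun A => \sum_(k < n) g k (c1 A) * d1 A ^+ k).
Proof.
move=> [[p fE] fU]; have [n pn] := size_taylor_d1 p.
exists n, (fun k B => (taylor_d1 p B)`_k); split=> [k|A _]; last first.
  by rewrite -(horner_coef_wide _ (pn _)) horner_taylor_d1 -c1_decomp.
split=> [|u ut B /andP[B_M1 _]]; first exact: polyfun_coef_taylor_d1.
congr (_ : {poly C})`_k; apply: poly_eq_eval => t; have uU := unitri_unitmx ut.
rewrite !horner_taylor_d1 -!fE -[RHS](fU u ut) ?inM1_scalarD //.
by rewrite mulmxDr mulmxDl mul_mx_scalar -scalemxAl mulVmx // scalemx1.
Qed.

(** For fixed B in N_1 the matrices (t/3) I + B stay in M_1, with trace t and image B under [c1]. So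
    the polynomial in t with coefficients [g k B] vanishes identically. *)
Lemma d1_expand_unique n (g : nat -> Mat -> C) :
  eqon inM1 (fun A => \sum_(k < n) g k (c1 A) * d1 A ^+ k) (fun=> 0) ->
  forall k, (k < n)%N -> eqon inN1 (g k) (fun=> 0).
Proof.
move=> g0 k kn B /andP[B_M1 /eqP trB].
have : \poly_(i < n) g i B = 0.
  apply: poly_eval0 => t; rewrite horner_poly.
  have := g0 ((t / 3%:R)%:M + B); rewrite inM1_scalarD => /(_ B_M1).
  by rewrite c1_scalarD (c1_id trB) (d1_scalarD _ trB).
by move/(congr1 (coefp k)); rewrite /= coef_poly kn coef0.
Qed.

Definition gensM1 (A : 'M[C]_3) : 'I_5 -> C :=
  tnth [tuple d1 A; d2 A; d3 A; c1U A; c2U A].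

Lemma coordU_phi p : coordU inM1 (phi p).
Proof.
apply: (@coordU_meval inM1 5 p (fun i A => gensM1 A i)) => i; rewrite /gensM1.
case: i => [[|[|[|[|[|//]]]]] i5].
- exact: coordU_d1.
- exact: coordU_d2.
- exact: coordU_d3.
- exact: coordU_c1U.
- exact: coordU_c2U.
Qed.

Lemma phi_surj f : coordU inM1 f -> exists p, eqon inM1 (phi p) f.
Proof.
move=> /coordU_inM1_expand[n [g [gN1 fE]]].
have /fin_all_exists[q qE] (k : 'I_n) : exists q : {mpoly C[4]},
    eqon inN1 (g k) (fun A => q.@[gensN1 A]) by apply: coordU_inN1_gens.
(* The four generators on N_1 become x_1, ..., x_4, while x_0 carries the trace. *)
exists (\sum_(k < n) (q k \mPo [tuple xv i.+1 | i < 4]) * xv 0 ^+ k) => A A_M1.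
rewrite fE // /phi raddf_sum; apply: eq_bigr => k _ /=.
rewrite qE ?inN1_c1 // mevalM (rmorphXn (meval _)) /= comp_mpoly_meval.
congr (_ * _ ^+ k); last by rewrite mevalXU (tnth_nth 0) inordK.
apply: meval_eq => i; rewrite tnth_mktuple mevalXU /gensN1 !(tnth_nth 0).
rewrite d2_c1 d3_c1 c1U_c1 c2U_c1 inordK; last by rewrite ltnS ltn_ord.
by case: i => [[|[|[|[|]]]]].
Qed.

(** * Relations between the generators *)

Section NormalForm.
Variables (R : comNzRingType) (x1 x2 x3 x4 : R).

Definition in_relations (p : R) := exists a1 a2 a3 a4 : R,
  p = a1 * (x1 ^+ 3 - x2 ^+ 2) + a2 * (x1 * x4 - x2 * x3)
    + a3 * (x4 ^+ 2 - x1 * x3 ^+ 2) + a4 * (x2 * x4 - x1 ^+ 2 * x3).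

(** Abstract stand-ins for the two polynomial subrings, so that each ideal membership below is an
    identity in an arbitrary commutative ring. *)
Variables S T : R -> Prop.
Hypothesis S_D : forall a b, S a -> S b -> S (a + b).
Hypothesis S_M : forall a b, S a -> S b -> S (a * b).
Hypotheses (Sx1 : S x1) (Sx3 : S x3).
Hypothesis T_D : forall a b, T a -> T b -> T (a + b).
Hypothesis T_M : forall a b, T a -> T b -> T (a * b).
Hypothesis T0 : T 0.
Hypothesis T_S : forall a, T a -> S a.
Hypothesis S_split : forall a, S a ->
  exists b c, [/\ T b, S c & a = b + x1 * c].

(* The relations rewrite every polynomial to a + x2 b + x4 c with
   a, b in S = C[x0, x1, x3] and c in T = C[x0, x3]. *)
Definition has_normal_form (p : R) := exists a b c,
  [/\ S a, S b, T c & in_relations (p - (a + x2 * b + x4 * c))].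

Lemma has_normal_formD p q :
  has_normal_form p -> has_normal_form q -> has_normal_form (p + q).
Proof.
move=> [a [b [c [Sa Sb Tc [r1 [r2 [r3 [r4 E]]]]]]]].
move=> [a' [b' [c' [Sa' Sb' Tc' [r1' [r2' [r3' [r4' E']]]]]]]].
exists (a + a'), (b + b'), (c + c'); split; [exact: S_D|exact: S_D|exact: T_D|].
exists (r1 + r1'), (r2 + r2'), (r3 + r3'), (r4 + r4').
transitivity ((p - (a + x2 * b + x4 * c)) + (q - (a' + x2 * b' + x4 * c'))).
  by ring.
by rewrite E E'; ring.
Qed.

Lemma has_normal_form1 : S 1 -> has_normal_form 1.
Proof.
move=> S1; exists 1, 0, 0; split=> //; first exact: T_S.
by exists 0, 0, 0, 0; ring.
Qed.

Lemma has_normal_formT d p :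
  T d -> has_normal_form p -> has_normal_form (d * p).
Proof.
move=> Td [a [b [c [Sa Sb Tc [r1 [r2 [r3 [r4 E]]]]]]]].
have Sd := T_S Td.
exists (d * a), (d * b), (d * c); split; [exact: S_M|exact: S_M|exact: T_M|].
exists (d * r1), (d * r2), (d * r3), (d * r4).
transitivity (d * (p - (a + x2 * b + x4 * c))); first by ring.
by rewrite E; ring.
Qed.

(** The only term to rewrite is x1 x4 c, which becomes x2 x3 c. *)
Lemma has_normal_form_x1 p : has_normal_form p -> has_normal_form (x1 * p).
Proof.
move=> [a [b [c [Sa Sb Tc [r1 [r2 [r3 [r4 E]]]]]]]]; have Sc := T_S Tc.
exists (x1 * a), (x1 * b + x3 * c), 0; split=> //.
- exact: S_M.
- by apply: S_D; apply: S_M.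
exists (x1 * r1), (x1 * r2 + c), (x1 * r3), (x1 * r4).
transitivity (x1 * (p - (a + x2 * b + x4 * c)) + c * (x1 * x4 - x2 * x3)).
  by ring.
by rewrite E; ring.
Qed.

(** Here x2^2 b becomes x1^3 b, and x2 x4 c becomes x1^2 x3 c. *)
Lemma has_normal_form_x2 p : has_normal_form p -> has_normal_form (x2 * p).
Proof.
move=> [a [b [c [Sa Sb Tc [r1 [r2 [r3 [r4 E]]]]]]]]; have Sc := T_S Tc.
exists (x1 * (x1 * (x1 * b)) + x1 * (x1 * (x3 * c))), a, 0; split=> //.
  by apply: S_D; do 3 apply: (S_M) => //.
exists (x2 * r1 - b), (x2 * r2), (x2 * r3), (x2 * r4 + c).
transitivity (x2 * (p - (a + x2 * b + x4 * c)) - b * (x1 ^+ 3 - x2 ^+ 2)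
  + c * (x2 * x4 - x1 ^+ 2 * x3)); first by ring.
by rewrite E; ring.
Qed.

(** The coefficient of x4 must be free of x1, so a is split as a0 + x1 a1 and x1 x4 a1 becomes x2 x3
    a1. The other terms use x2 x4 = x1^2 x3 and x4^2 = x1 x3^2. *)
Lemma has_normal_form_x4 p : has_normal_form p -> has_normal_form (x4 * p).
Proof.
move=> [a [b [c [Sa Sb Tc [r1 [r2 [r3 [r4 E]]]]]]]]; have Sc := T_S Tc.
have [a0 [a1 [Ta0 Sa1 aE]]] := S_split Sa.
exists (x1 * (x1 * (x3 * b)) + x1 * (x3 * (x3 * c))), (x3 * a1), a0; split=> //.
- by apply: S_D; do 3 apply: (S_M) => //.
- exact: S_M.
exists (x4 * r1), (x4 * r2 + a1), (x4 * r3 + c), (x4 * r4 + b).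
transitivity (x4 * (p - (a + x2 * b + x4 * c)) + a1 * (x1 * x4 - x2 * x3)
  + c * (x4 ^+ 2 - x1 * x3 ^+ 2) + b * (x2 * x4 - x1 ^+ 2 * x3)).
  by rewrite aE; ring.
by rewrite E; ring.
Qed.

End NormalForm.

Lemma rmorph_in_relations (R S : comNzRingType) (f : {rmorphism R -> S})
    (x1 x2 x3 x4 p : R) z D :
  f x1 = z ^+ 2 -> f x2 = z ^+ 3 -> f x3 = D -> f x4 = z * D ->
  in_relations x1 x2 x3 x4 p -> f p = 0.
Proof.
move=> f1 f2 f3 f4 [r1 [r2 [r3 [r4 ->]]]].
have fD : {morph f : x y / x + y} := rmorphD f.
have fB : {morph f : x y / x - y} := rmorphB f.
have fM : {morph f : x y / x * y} := rmorphM f.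
rewrite !exprSr !expr0 !mul1r !(fM, fB, fD) f1 f2 f3 f4; ring.
Qed.

Definition vars013 : 3.-tuple {mpoly C[5]} := [tuple xv 0; xv 1; xv 3].
Definition vars03 : 2.-tuple {mpoly C[5]} := [tuple xv 0; xv 3].
Definition poly013 (p : {mpoly C[5]}) := exists q, p = q \mPo vars013.
Definition poly03 (p : {mpoly C[5]}) := exists q, p = q \mPo vars03.

Lemma poly013D p q : poly013 p -> poly013 q -> poly013 (p + q).
Proof. by move=> [a ->] [b ->]; exists (a + b); rewrite comp_mpolyD. Qed.

Lemma poly013M p q : poly013 p -> poly013 q -> poly013 (p * q).
Proof. by move=> [a ->] [b ->]; exists (a * b); rewrite comp_mpolyM. Qed.

Lemma poly03D p q : poly03 p -> poly03 q -> poly03 (p + q).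
Proof. by move=> [a ->] [b ->]; exists (a + b); rewrite comp_mpolyD. Qed.

Lemma poly03M p q : poly03 p -> poly03 q -> poly03 (p * q).
Proof. by move=> [a ->] [b ->]; exists (a * b); rewrite comp_mpolyM. Qed.

Lemma poly03C c : poly03 c%:MP.
Proof. by exists c%:MP; rewrite comp_mpolyC. Qed.

Lemma poly013_xv : [/\ poly013 (xv 0), poly013 (xv 1) & poly013 (xv 3)].
Proof.
by split; [exists 'X_(inord 0)|exists 'X_(inord 1)|exists 'X_(inord 2)];
   rewrite comp_mpolyXU inordK.
Qed.

Lemma poly03_xv : poly03 (xv 0) /\ poly03 (xv 3).
Proof.
by split; [exists 'X_(inord 0)|exists 'X_(inord 1)];
   rewrite comp_mpolyXU inordK.
Qed.

Lemma poly03_013 p : poly03 p -> poly013 p.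
Proof.
have [S0 S1 S3] := poly013_xv.
move=> [q ->]; elim/mpoly_ring_ind: q => [c|i|p1 p2 IH1 IH2|p1 p2 IH1 IH2].
- by exists c%:MP; rewrite !comp_mpolyC.
- by rewrite comp_mpolyXU; case: i => [[|[|//]]].
- by rewrite comp_mpolyD; apply: poly013D; [exact: IH1|exact: IH2].
- by rewrite comp_mpolyM; apply: poly013M; [exact: IH1|exact: IH2].
Qed.

Lemma poly013_split p : poly013 p ->
  exists b c, [/\ poly03 b, poly013 c & p = b + xv 1 * c].
Proof.
have [S0 S1 S3] := poly013_xv; have [T0 T3] := poly03_xv.
have C0 : poly03 0 by rewrite -mpolyC0; apply: poly03C.
have C1 : poly03 1 by rewrite -mpolyC1; apply: poly03C.
have inT q : poly03 q ->
    exists b c, [/\ poly03 b, poly013 c & q = b + xv 1 * c].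
  move=> Tq; exists q, 0; rewrite mulr0 [RHS]addr0.
  by split; [done|exact: poly03_013|done].
move=> [q ->]; elim/mpoly_ring_ind: q => [c|i|p1 p2|p1 p2].
- by rewrite comp_mpolyC; apply/inT/poly03C.
- rewrite comp_mpolyXU; case: i => [[|[|[|//]]] i3]; [exact: inT| |exact: inT].
  exists 0, 1; rewrite mulr1 [RHS]add0r.
  by split; [done|exact: poly03_013|done].
- move=> [b1 [c1 [Tb1 Sc1 E1]]] [b2 [c2 [Tb2 Sc2 E2]]].
  exists (b1 + b2), (c1 + c2).
  rewrite comp_mpolyD E1 E2.
  split; [exact: (poly03D Tb1 Tb2)|exact: (poly013D Sc1 Sc2)|].
  by rewrite mulrDr addrACA.
- move=> [b1 [c1 [Tb1 Sc1 E1]]] [b2 [c2 [Tb2 Sc2 E2]]].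
  exists (b1 * b2), (b1 * c2 + c1 * b2 + xv 1 * (c1 * c2)).
  rewrite comp_mpolyM E1 E2; split; first exact: (poly03M Tb1 Tb2).
    have [Sb1 Sb2] := (poly03_013 Tb1, poly03_013 Tb2).
    apply: poly013D; first by apply: poly013D; exact: poly013M.
    by apply: (poly013M S1); exact: poly013M.
  by move: (xv 1) => x; ring.
Qed.

Lemma mpoly5_normal_form p :
  has_normal_form (xv 1) (xv 2) (xv 3) (xv 4) poly013 poly03 p.
Proof.
have [S0 S1 S3] := poly013_xv; have [T0 T3] := poly03_xv.
have C0 : poly03 0 by rewrite -mpolyC0; apply: poly03C.
have nfT := has_normal_formT (x1 := xv 1) (x2 := xv 2) (x3 := xv 3) (x4 := xv 4)
  poly013M poly03M poly03_013.
(* Stability under multiplication by every p passes through products in the induction on p; it is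
   then applied to q = 1. *)
suff nfM q : has_normal_form (xv 1) (xv 2) (xv 3) (xv 4) poly013 poly03 q ->
    has_normal_form (xv 1) (xv 2) (xv 3) (xv 4) poly013 poly03 (p * q).
  rewrite -[p]mulr1; apply: nfM; apply: has_normal_form1 C0 poly03_013 _.
  by rewrite -mpolyC1; apply/poly03_013/poly03C.
elim/mpoly_ring_ind: p q => [c|i|p1 p2 IH1 IH2|p1 p2 IH1 IH2] q nfq.
- exact: (nfT _ _ (poly03C c) nfq).
- rewrite -(inord_val i); case: i => [[|[|[|[|[|//]]]]] i5] /=.
  + exact: (nfT _ _ T0 nfq).
  + exact: (has_normal_form_x1 poly013D poly013M S1 S3 C0 poly03_013 nfq).
  + exact: (has_normal_form_x2 poly013D poly013M S1 S3 C0 poly03_013 nfq).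
  + exact: (nfT _ _ T3 nfq).
  + exact: (has_normal_form_x4 poly013D poly013M S1 S3 poly03_013
      poly013_split nfq).
- rewrite mulrDl.
  exact: (has_normal_formD poly013D poly03D (IH1 _ nfq) (IH2 _ nfq)).
- by rewrite -mulrA; apply/IH1/IH2/nfq.
Qed.

Definition cusp_point (t z D : C) : 'I_5 -> C :=
  tnth [tuple t; z ^+ 2; z ^+ 3; D; z * D].

(** The five generators map M_1 exactly onto the set of points (t, z^2, z^3, D, zD): slice matrices
    plus scalars reach all of them. *)
Lemma phi_eq0 p : eqon inM1 (phi p) (fun=> 0) <->
  forall t z D, p.@[cusp_point t z D] = 0.
Proof.
split=> [p0 t z D|p0 A A_M1].
  set B := c1 (section_col *m section_row z D).
  have BN : inN1 B by apply: inN1_outer.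
  have [B_M1 /eqP trB] := andP BN.
  have := p0 ((t / 3%:R)%:M + B); rewrite inM1_scalarD => /(_ B_M1) <-.
  apply: meval_eq => i; rewrite /cusp_point.
  have cB : c1 ((t / 3%:R)%:M + B) = B by rewrite c1_scalarD c1_id.
  rewrite -[d2 (_ + _)]d2_c1 -[d3 (_ + _)]d3_c1 -[c1U (_ + _)]c1U_c1.
  rewrite -[c2U (_ + _)]c2U_c1 cB d1_scalarD //.
  rewrite d2_outer d3_outer c1U_outer c2U_outer.
  by rewrite zcoord_section Dcoord_section.
have [v [w cA]] := inM1_c1P A_M1.
rewrite -(p0 (d1 A) (zcoord v w) (Dcoord v w)); apply: meval_eq => i.
rewrite /cusp_point -[d2 A]d2_c1 -[d3 A]d3_c1 -[c1U A]c1U_c1 -[c2U A]c2U_c1 cA.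
by rewrite d2_outer d3_outer c1U_outer c2U_outer.
Qed.

Lemma meval_poly013 (a : {mpoly C[3]}) t z D :
  (a \mPo vars013).@[cusp_point t z D] = a.@[tnth [tuple t; z ^+ 2; D]].
Proof.
rewrite comp_mpoly_meval; apply: meval_eq => -[[|[|[|//]]] i3];
by rewrite !(tnth_nth 0) /= mevalXU /cusp_point (tnth_nth 0) inordK.
Qed.

Lemma meval_poly03 (c : {mpoly C[2]}) t z D :
  (c \mPo vars03).@[cusp_point t z D] = c.@[zD t D].
Proof.
rewrite comp_mpoly_meval; apply: meval_eq => -[[|[|//]] i2];
by rewrite /zD !(tnth_nth 0) /= mevalXU /cusp_point (tnth_nth 0) inordK.
Qed.

Lemma closed_sqrt (F : closedFieldType) (s : F) : exists z, z ^+ 2 = s.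
Proof.
have [|z] := closed_rootP ('X^2 - s%:P) _; first by rewrite size_XnsubC.
by rewrite /root hornerD hornerN hornerXn hornerC subr_eq0 => /eqP; exists z.
Qed.

(** The first term is even in z and the other two are odd, so adding the identities for z and -z
    gives 2a = 0, and every s is some z^2. Cancelling z leaves z^2 b + D c = 0; at z = 0 this gives
    c = 0, and then b = 0. *)
Lemma normal_form_eq0 (a b : {mpoly C[3]}) (c : {mpoly C[2]}) :
  (forall t z D, a.@[tnth [tuple t; z ^+ 2; D]]
    + z ^+ 3 * b.@[tnth [tuple t; z ^+ 2; D]] + z * D * c.@[zD t D] = 0) ->
  [/\ a = 0, b = 0 & c = 0].
Proof.
move=> abc0.
have ev3 (q : {mpoly C[3]}) :
    (forall t s D, q.@[tnth [tuple t; s; D]] = 0) -> q = 0.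
  move=> q0; apply: mpoly_eval0 => x.
  rewrite -(q0 (x (inord 0)) (x (inord 1)) (x (inord 2))); apply: meval_eq.
  case=> [[|[|[|//]]] i3]; rewrite (tnth_nth 0) /=;
  by congr x; apply/val_inj; rewrite /= inordK.
have ev2 (q : {mpoly C[2]}) : (forall t D, q.@[zD t D] = 0) -> q = 0.
  move=> q0; apply: mpoly_eval0 => x.
  rewrite -(q0 (x (inord 0)) (x (inord 1))); apply: meval_eq.
  case=> [[|[|//]] i3]; rewrite /zD (tnth_nth 0) /=;
  by congr x; apply/val_inj; rewrite /= inordK.
have pb F G H : polyfun1 F -> polyfun1 G -> polyfun1 H ->
    polyfun1 (fun y => b.@[tnth [tuple F y; G y; H y]]).
  move=> FP GP HP.
  apply: (@polyfun1_meval 3 b (fun i y => tnth [tuple F y; G y; H y] i)).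
  by case=> [[|[|[|//]]] i3].
have a0 : a = 0.
  apply: ev3 => t s D; have [z <-] := closed_sqrt s.
  have := abc0 t (- z) D; have := abc0 t z D; rewrite sqrrN.
  set u := a.@[_]; set w := b.@[_] => E1 E2; apply: (mulIf (natrC_neq0 1)).
  rewrite mul0r -[RHS]addr0 -{1}E1 -E2; ring.
have bc0 t z D : z ^+ 2 * b.@[tnth [tuple t; z ^+ 2; D]] + D * c.@[zD t D] = 0.
  apply: (polyfun1_cancel polyfun1_id (g := fun z =>
    z ^+ 2 * b.@[tnth [tuple t; z ^+ 2; D]] + D * c.@[zD t D])) z => [||y].
  - have p2 := polyfun1M polyfun1_id polyfun1_id.
    apply: polyfun1D (polyfun1_cst _); apply: (polyfun1M p2).
    exact: pb (polyfun1_cst t) p2 (polyfun1_cst D).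
  - by exists 1; rewrite oner_eq0.
  - by rewrite -(abc0 t y D) a0 meval0; ring.
have c0 : c = 0.
  apply: ev2 => t D.
  apply: (polyfun1_cancel polyfun1_id (g := fun D => c.@[zD t D])) D => [||D].
  - apply: (@polyfun1_meval 2 c (fun i y => zD t y i)).
    case=> [[|[|//]] i2]; [exact: polyfun1_cst|exact: polyfun1_id].
  - by exists 1; rewrite oner_eq0.
  - by have := bc0 t 0 D; rewrite expr2 !mul0r add0r.
split=> //; apply: ev3 => t s D.
apply: (polyfun1_cancel polyfun1_id
  (g := fun s => b.@[tnth [tuple t; s; D]])) s => [||s].
- exact: pb (polyfun1_cst t) polyfun1_id (polyfun1_cst D).
- by exists 1; rewrite oner_eq0.
- have [z <-] := closed_sqrt s.
  by have := bc0 t z D; rewrite c0 meval0 mulr0 addr0.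
Qed.

(** The relations vanish at all cusp points. So if p vanishes there, its normal form does too and is
    therefore zero, which leaves p in the ideal. *)
Lemma phi_ker p :
  eqon inM1 (phi p) (fun=> 0) <-> in_relations (xv 1) (xv 2) (xv 3) (xv 4) p.
Proof.
have xvE t z D : [/\ (xv 1).@[cusp_point t z D] = z ^+ 2,
    (xv 2).@[cusp_point t z D] = z ^+ 3, (xv 3).@[cusp_point t z D] = D
    & (xv 4).@[cusp_point t z D] = z * D].
  by split; rewrite mevalXU /cusp_point (tnth_nth 0) inordK.
have rel0 q t z D : in_relations (xv 1) (xv 2) (xv 3) (xv 4) q ->
    q.@[cusp_point t z D] = 0.
  have [E1 E2 E3 E4] := xvE t z D.
  exact: (rmorph_in_relations (f := meval (cusp_point t z D)) E1 E2 E3 E4).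
rewrite phi_eq0; split=> [p0|rp t z D]; last exact: rel0.
have [_ [_ [_ [[a ->] [b ->] [c ->] rp]]]] := mpoly5_normal_form p.
have [|a0 b0 c0] := @normal_form_eq0 a b c.
  move=> t z D; have [_ E2 _ E4] := xvE t z D.
  have := rel0 _ t z D rp; rewrite mevalB p0 sub0r => /eqP; rewrite oppr_eq0.
  move=> /eqP <-; rewrite -(meval_poly013 a) -(meval_poly013 b).
  rewrite -(meval_poly03 c _ z) -E2 -E4.
  move: (a \mPo _) (b \mPo _) (c \mPo _) (xv 2) (xv 4) => A B G X Y.
  by rewrite !mevalD !mevalM.
move: rp; rewrite a0 b0 c0 !comp_mpoly0 !mulr0 !addr0.
by rewrite subr0.
Qed.

Theorem theorem4p5 :
  (* (i) C[M_1]^U is a polynomial ring in d1-bar over C[N_1]^U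
         (embedded via f |-> f o c1) *)
  ( coordU inM1 d1 /\
    (forall g, coordU inN1 g -> coordU inM1 (fun A => g (c1 A))) /\
    (forall f, coordU inM1 f ->
       exists (n : nat) (g : nat -> Mat -> C),
         (forall k, coordU inN1 (g k)) /\
         eqon inM1 f (fun A => \sum_(k < n) g k (c1 A) * d1 A ^+ k)) /\
    (forall (n : nat) (g : nat -> Mat -> C),
       (forall k, coordU inN1 (g k)) ->
       eqon inM1 (fun A => \sum_(k < n) g k (c1 A) * d1 A ^+ k) (fun _ => 0) ->
       forall k, (k < n)%N -> eqon inN1 (g k) (fun _ => 0)) ) /\
  (* (ii) C-algebra isomorphism eta : C[z^2,z^3,D,zD] -> C[N_1]^U *)
  ( exists eta : {mpoly C[2]} -> Mat -> C,
      eqon inN1 (eta 1) (fun _ => 1) /\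
      (forall p q, in_subalg p -> in_subalg q ->
         eqon inN1 (eta (p + q)) (fun A => eta p A + eta q A)) /\
      (forall (a : C) p, in_subalg p ->
         eqon inN1 (eta (a *: p)) (fun A => a * eta p A)) /\
      (forall p q, in_subalg p -> in_subalg q ->
         eqon inN1 (eta (p * q)) (fun A => eta p A * eta q A)) /\
      (forall p, in_subalg p -> coordU inN1 (eta p)) /\
      (forall p q, in_subalg p -> in_subalg q ->
         eqon inN1 (eta p) (eta q) -> p = q) /\
      (forall f, coordU inN1 f -> exists2 p, in_subalg p & eqon inN1 (eta p) f) /\
      eqon inN1 (eta (zz ^+ 2)) d2 /\
      eqon inN1 (eta (zz ^+ 3)) d3 /\
      eqon inN1 (eta DD) c1U /\
      eqon inN1 (eta (zz * DD)) c2U ) /\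
  (* (iii) phi is a surjection onto C[M_1]^U with the given kernel *)
  ( (forall p, coordU inM1 (phi p)) /\
    (forall f, coordU inM1 f -> exists p, eqon inM1 (phi p) f) /\
    (forall p : {mpoly C[5]},
       eqon inM1 (phi p) (fun _ => 0) <->
       exists a1 a2 a3 a4 : {mpoly C[5]},
         p = a1 * (xv 1 ^+ 3 - xv 2 ^+ 2)
           + a2 * (xv 1 * xv 4 - xv 2 * xv 3)
           + a3 * (xv 4 ^+ 2 - xv 1 * xv 3 ^+ 2)
           + a4 * (xv 2 * xv 4 - xv 1 ^+ 2 * xv 3)) ).
Proof.
split; [|split].
- split; first exact: coordU_d1.
  split; first exact: coordU_c1.
  split; first exact: coordU_inM1_expand.
  by move=> n g _; apply: d1_expand_unique.
- exists eta.
  have [s2 s3 sD szD] := in_subalg_gens.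
  split; [|split; [|split; [|split; [|split; [|split; [|split; [|split;
    [|split; [|split]]]]]]]]].
  + move=> A /inN1P[v [w ->]]; rewrite eta_outer ?meval1 //; exact: in_subalg1.
  + move=> p q sp sq A /inN1P[v [w ->]].
    by rewrite !eta_outer ?mevalD //; apply: in_subalgD.
  + move=> a p sp A /inN1P[v [w ->]].
    by rewrite !eta_outer ?mevalZ //; apply: in_subalgZ.
  + move=> p q sp sq A /inN1P[v [w ->]].
    by rewrite !eta_outer ?mevalM //; apply: in_subalgM.
  + move=> p _; exact: coordU_gensN1.
  + exact: eta_inj.
  + move=> f /coordU_inN1_gens[q fq].
    have sq : in_subalg (q \mPo subalg_gens) by exists q.
    exists (q \mPo subalg_gens) => // A AN; rewrite fq //.
    by have [v [w ->]] := inN1P AN; rewrite eta_outer // meval_gensN1.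
  + move=> A /inN1P[v [w ->]].
    by rewrite eta_outer // d2_outer rmorphXn /= mevalXU /zD (tnth_nth 0)
      inordK.
  + move=> A /inN1P[v [w ->]].
    by rewrite eta_outer // d3_outer rmorphXn /= mevalXU /zD (tnth_nth 0)
      inordK.
  + move=> A /inN1P[v [w ->]].
    by rewrite eta_outer // c1U_outer mevalXU /zD (tnth_nth 0) inordK.
  + move=> A /inN1P[v [w ->]].
    by rewrite eta_outer // c2U_outer mevalM !mevalXU /zD !(tnth_nth 0) !inordK.
- split; first exact: coordU_phi.
  split; first exact: phi_surj.
  exact: phi_ker.
Qed.
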